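(* For every integer $n\ge 1$, every sum-free set $A\subseteq[n]$ such that $2n+1\notin(3A)\cup(4A)$ satisfies $$|A|\le\left\lfloor\tfrac13(n+1)\right\rfloor .$$
   Context: $[n]=\{1,\ldots,n\}$. A set $A$ of integers is sum-free if there are no (not necessarily distinct) $x,y,z\in A$ with $x+y=z$. For $k\ge 0$, $kA=\{a_1+\cdots+a_k\mid a_1,\ldots,a_k\in A\}$ (repetitions allowed). *)

(* Defs.v *)
From mathcomp Require Import all_boot finmap.

Set Implicit Arguments.
Unset Strict Implicit.
Unset Printing Implicit Defensive.

Local Open Scope fset_scope.

(* [n] = {1, ..., n}: iota takes a start and a length. *)
Definition interval (n : nat) : {fset nat} := [fset i in iota 1 n].

Definition sum_free (A : {fset nat}) : Prop :=
  forall x y z : nat, x \in A -> y \in A -> z \in A -> (x + y)%N <> z.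

(* The k-fold sumset kA; a : 'I_k -> A is the tuple (a_1, ..., a_k), so
   repetitions are allowed and 0A = {0}. *)
Definition sumset (k : nat) (A : {fset nat}) : {fset nat} :=
  [fset (\sum_(i < k) val (a i))%N | a : {ffun 'I_k -> A} in predT].

(* Main.v *)
Require Import Defs.
From mathcomp Require Import all_boot finmap zify.

(** Modulo [2n + 1], the four sets [A], [-A], [A + A] and [-(A + A)] are
    pairwise disjoint and avoid [0], whence [|A| + |A + A| <= n]; it remains
    to use [|A + A| >= 2 |A| - 1], which holds for sets of integers. *)

Local Open Scope fset_scope.
Local Open Scope nat_scope.

(** Reduces membership in a sumset to an explicit list of summands, so that no finite function has
    to be built later. *)
Lemma sumn_in_sumset (A : {fset nat}) (s : seq nat) :
  {subset s <= A} -> sumn s \in sumset (size s) A.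
Proof.
move=> sA.
have nA (i : 'I_(size s)) : nth 0 s i \in A by apply/sA/mem_nth.
apply/imfsetP; exists [ffun i => [` nA i]] => //.
rewrite sumnE (big_nth 0) big_mkord.
by apply: eq_bigr => i _; rewrite ffunE.
Qed.

Lemma fset_nat_min (A : {fset nat}) :
  A != fset0 -> exists2 a, a \in A & {in A, forall x, a <= x}.
Proof.
case/fset0Pn=> x0 x0A; have exA : exists x, x \in A by exists x0.
by case: (ex_minnP exA) => a aA amin; exists a.
Qed.

Lemma fset_nat_max (A : {fset nat}) :
  A != fset0 -> exists2 b, b \in A & {in A, forall x, x <= b}.
Proof.
case/fset0Pn=> x0 x0A; have exA : exists x, x \in A by exists x0.
have ubA x : x \in A -> x <= \max_(y <- A) y by move=> xA; apply: leq_bigmax_seq.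
by case: (ex_maxnP exA ubA) => b bA bmax; exists b.
Qed.

Lemma card_add_fset (A B : {fset nat}) :
  A != fset0 -> B != fset0 ->
  #|` A| + #|` B| <= #|` [fset x + y | x in A, y in B]|.+1.
Proof.
move=> /fset_nat_max[a aA amax] /fset_nat_min[b bB bmin].
(* [A + b] lies below [a + b] and [a + B] above it. *)
have cA : #|` [fset x + b | x in A]| = #|` A|.
  by rewrite card_imfset //= => x y /addIn.
have cB : #|` [fset a + y | y in B]| = #|` B|.
  by rewrite card_imfset //= => x y /addnI.
(* Inclusion-exclusion: the union of the two translates lies in [A + B], and their intersection in
   [{a + b}], whence the successor. *)
rewrite -cA -cB -cardfsUI -addn1 leq_add //.
  apply/fsubset_leq_card/fsubsetP => z /fsetUP[] /imfsetP[x /= xAB ->].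
    exact: in_imfset2.
  exact: in_imfset2.
rewrite -(cardfs1 (a + b)); apply/fsubset_leq_card/fsubsetP => z.
case/fsetIP=> /imfsetP[x /= xA ->] /imfsetP[y /= yB xbE]; rewrite inE.
have := amax x xA; have := bmin y yB; lia.
Qed.

Theorem theorem3p1 (n : nat) (A : {fset nat}) :
  (1 <= n)%N ->
  A `<=` interval n ->
  sum_free A ->
  (2 * n + 1)%N \notin sumset 3 A `|` sumset 4 A ->
  (#|` A| <= (n + 1) %/ 3)%N.
Proof.
move=> _ /fsubsetP AI sfA; rewrite in_fsetU negb_or => /andP[not3 not4].
have [->|A0] := eqVneq A fset0; first by rewrite cardfs0.
have Abound x : x \in A -> 0 < x <= n.
  by move=> /AI; rewrite in_fset mem_iota; lia.
have no3 x y z : x \in A -> y \in A -> z \in A -> x + y + z <> 2 * n + 1.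
  move=> xA yA zA E; move: not3; rewrite -E.
  have /= := @sumn_in_sumset A [:: x; y; z].
  rewrite addn0 addnA => -> // t; rewrite !inE.
  by case/or3P=> /eqP->.
have no4 x y z t : x \in A -> y \in A -> z \in A -> t \in A ->
    x + y + (z + t) <> 2 * n + 1.
  move=> xA yA zA tA E; move: not4; rewrite -E.
  have /= := @sumn_in_sumset A [:: x; y; z; t].
  rewrite addn0 addnA => -> // u; rewrite !inE.
  by case/or4P=> /eqP->.
set D := [fset x + y | x in A, y in A].
have cD : #|` A| + #|` A| <= #|` D|.+1 by apply: card_add_fset.
(* The representative of [u] up to sign modulo [2n + 1]. *)
pose fold u := minn u (2 * n + 1 - u).
(* If [fold u = fold v], then [u = v] or [u + v = 2 * n + 1]; [no4] rules out the latter. *)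
have cF : #|` [fset fold u | u in D]| = #|` D|.
  apply: card_in_imfset => u v /= /imfset2P[x /= xA [y /= yA uE]].
  case/imfset2P=> z /= zA [t /= tA vE].
  have := no4 x y z t xA yA zA tA.
  by have := Abound x xA; have := Abound y yA; have := Abound z zA;
    have := Abound t tA; rewrite /fold; lia.
(* For [z] in [A], [z = fold u] means [u = z], against sum-freeness, or [u + z = 2 * n + 1], against
   [no3]. *)
have AF0 : A `&` [fset fold u | u in D] = fset0.
  apply/fsetP => z; rewrite in_fset0; apply/negP => /fsetIP[zA].
  case/imfsetP=> u /= /imfset2P[x /= xA [y /= yA uE]] zE.
  have := no3 x y z xA yA zA; have := sfA x y z xA yA zA.
  by have := Abound x xA; have := Abound y yA; move: zE; rewrite /fold; lia.
(* Since [2 <= u <= 2 * n], both [u] and [2 * n + 1 - u] are positive; their sum is odd, so the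
   smaller is at most [n]. *)
have AFI : A `|` [fset fold u | u in D] `<=` interval n.
  apply/fsubsetP => z /fsetUP[/AI//|].
  case/imfsetP=> u /= /imfset2P[x /= xA [y /= yA uE]] zE.
  rewrite in_fset mem_iota.
  by have := Abound x xA; have := Abound y yA; move: zE; rewrite /fold; lia.
have cI : #|` interval n| = n.
  by rewrite card_fseq undup_id ?iota_uniq ?size_iota.
(* Disjointness gives [|A| + |D| <= n]; with [2|A| <= |D| + 1] this yields [3|A| <= n + 1]. *)
have := fsubset_leq_card AFI.
have := cardfsUI A [fset fold u | u in D].
rewrite AF0 cardfs0 cF cI leq_divRL //; lia.
Qed.
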